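(* Let $\alpha>\beta>0$ and $L>0$, and let $\mathcal{H}$ be an infinite dimensional Hilbert space with fixed orthonormal basis $\{|e_j\rangle\}_{j\ge0}$. Consider the i.i.d. quantum model $\mathcal{Q}_n=\{|\psi\rangle\langle\psi|^{\otimes n}:|\psi\rangle\langle\psi|\in S^\alpha(L)\}$ and the functional $F(\psi)=\sum_{j\ge0}|\psi_j|^2j^{2\beta}$, and let $$\eta_n^2=\begin{cases}n^{-1},&\text{if }\alpha\ge2\beta,\\ n^{-2(1-\beta/\alpha)},&\text{if }\beta<\alpha<2\beta.\end{cases}$$ Then there exists a constant $c>0$ depending only on $\alpha$, $\beta$ and $L$ such that $$\liminf_{n\to\infty}\ \inf_{\widehat F_n}\ \sup_{\psi\in S^\alpha(L)}\eta_n^{-2}\,\mathbb{E}_\psi\left(\widehat F_n-F(\psi)\right)^2\ge c,$$ where the infimum is taken over all measurements and resulting estimators $\widehat F_n$ of $F(\psi)$.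
   Context: The Hermite-Sobolev class is $S^\alpha(L)=\{|\psi\rangle\langle\psi|:\ \sum_{j=0}^\infty|\psi_j|^2j^{2\alpha}\le L,\ \|\psi\|=1\}$, where $\psi_j=\langle e_j|\psi\rangle$; $\psi\in S^\alpha(L)$ means $|\psi\rangle\langle\psi|\in S^\alpha(L)$. An estimator $\widehat F_n$ is a real-valued random variable obtained by an arbitrary (possibly collective) measurement on $|\psi\rangle\langle\psi|^{\otimes n}$, i.e. a positive operator valued measure $M$ on $\mathcal{H}^{\otimes n}$ ($M(E)\ge0$, $\sigma$-additive, total mass $\mathbf1$) whose outcome has law $E\mapsto\mathrm{Tr}(|\psi\rangle\langle\psi|^{\otimes n}M(E))$, followed by a classical estimator applied to the outcome; $\mathbb{E}_\psi$ is the corresponding expectation. *)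

(* Defs.v *)
From HB Require Import structures.
From mathcomp Require Import all_boot all_order all_algebra.
From mathcomp Require Import complex sesquilinear finmap.
From mathcomp Require Import all_classical all_reals all_analysis.
From mathcomp Require Import summability.
From mathcomp Require Import ring.

Set Implicit Arguments.
Unset Strict Implicit.
Unset Printing Implicit Defensive.

Import Order.TTheory GRing.Theory Num.Theory.
Import numFieldNormedType.Exports.

Local Open Scope classical_set_scope.
Local Open Scope ring_scope.

#[local] Existing Instance totally_filter.

Record hilbertType (R : realType) := HilbertType {
  hilbert_sort :> completeNormedModType R[i];
  hdot : {dot hilbert_sort for Num.conj};
  hdot_norm : forall x, hdot x x = `|x| ^+ 2 }.

(* [hdot] is linear on the left; [braket x y] is the physicists' <x|y>, linear
   on the right. *)
Definition braket (R : realType) (V : hilbertType R) (x y : V) : R[i] :=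
  hdot V y x.

Definition ketbra (R : realType) (V : hilbertType R) (x : V) : V -> V :=
  fun v => braket x v *: x.

Definition hspan (R : realType) (V : hilbertType R) (I : Type) (b : I -> V) :
    set V :=
  [set x | exists s : seq (R[i] * I), x = \sum_(p <- s) p.1 *: b p.2].

Definition orthonormal_basis (R : realType) (V : hilbertType R) (I : eqType)
    (b : I -> V) : Prop :=
  (forall i j, braket (b i) (b j) = (i == j)%:R) /\ dense (hspan b).

(* Sum over the net of finite subsets of the index set. *)
Definition trace (R : realType) (V : hilbertType R) (I : choiceType)
    (b : I -> V) (A : V -> V) : R[i] :=
  summability.sum (fun i => braket (b i) (A (b i)) : R[i]^o).

Section braket_theory.
Variables (R : realType) (V : hilbertType R).
Implicit Types (x y z : V) (a : R[i]).

Lemma braketDr z x y : braket z (x + y) = braket z x + braket z y.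
Proof. by rewrite /braket linearDl. Qed.

Lemma braketZr z a x : braket z (a *: x) = a * braket z x.
Proof. by rewrite /braket linearZl_LR. Qed.

Lemma braketDl z x y : braket (x + y) z = braket x z + braket y z.
Proof. by rewrite /braket linearDr. Qed.

Lemma braketZl z a x : braket (a *: x) z = a^* * braket x z.
Proof. by rewrite /braket linearZr_LR. Qed.

Lemma braketC x y : (braket x y)^* = braket y x.
Proof. by rewrite /braket (hermC (hdot V) x y) expr0 mul1r. Qed.

Lemma braketxx x : braket x x = `|x| ^+ 2.
Proof. exact: hdot_norm. Qed.

Lemma braket0r z : braket z 0 = 0.
Proof. by rewrite -(scale0r 0) braketZr mul0r. Qed.

Lemma braket0l z : braket 0 z = 0.
Proof. by rewrite -braketC braket0r conjC0. Qed.

Lemma braketNr z x : braket z (- x) = - braket z x.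
Proof. by rewrite -scaleN1r braketZr mulN1r. Qed.

Lemma braketBr z x y : braket z (x - y) = braket z x - braket z y.
Proof. by rewrite braketDr braketNr. Qed.

Lemma braketNl z x : braket (- x) z = - braket x z.
Proof. by rewrite -braketC braketNr rmorphN /= braketC. Qed.

Lemma braketBl z x y : braket (x - y) z = braket x z - braket y z.
Proof. by rewrite braketDl braketNl. Qed.

Lemma braket_sumr (I : Type) (s : seq I) (P : pred I) (F : I -> V) z :
  braket z (\sum_(i <- s | P i) F i) = \sum_(i <- s | P i) braket z (F i).
Proof.
by apply: (big_morph (braket z)); [exact: braketDr|exact: braket0r].
Qed.

Lemma braket_suml (I : Type) (s : seq I) (P : pred I) (F : I -> V) z :
  braket (\sum_(i <- s | P i) F i) z = \sum_(i <- s | P i) braket (F i) z.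
Proof.
apply: (big_morph (fun x => braket x z)) => [x y|].
  exact: braketDl.
exact: braket0l.
Qed.

Lemma braket_CauchySchwarz x y : `|braket x y| <= `|x| * `|y|.
Proof.
have [->|x0] := eqVneq x 0; first by rewrite braket0l !normr0 mul0r.
have nx0 : 0 < `|x| by rewrite normr_gt0.
have xx0 : braket x x != 0 by rewrite braketxx expf_neq0// gt_eqF.
suff h : `|braket x y| ^+ 2 <= (`|x| * `|y|) ^+ 2.
  by rewrite -(@ler_pXn2r _ 2)// nnegrE// mulr_ge0.
pose a := braket x y / braket x x.
have : 0 <= braket (y - a *: x) (y - a *: x) by rewrite braketxx exprn_ge0.
rewrite braketBr !braketBl !braketZr !braketZl.
have axx : a^* * braket x x = braket y x.
  by rewrite /a rmorphM fmorphV /= !braketC divfK.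
rewrite axx subrr subr0 subr_ge0 -(ler_pM2r (_ : 0 < braket x x)).
  rewrite mulrAC axx -(braketC x y) mulrC -normCK !braketxx.
  by rewrite exprMn mulrC.
by rewrite braketxx exprn_gt0.
Qed.

Lemma braket_continuousr x : continuous (braket x : V -> R[i]^o).
Proof.
move=> y; apply/cvgrPdist_lt => eps eps0.
have x1 : 0 < `|x| + 1 by rewrite ltr_wpDl.
near=> z; rewrite -braketBr (le_lt_trans (braket_CauchySchwarz _ _))//.
apply: (@le_lt_trans _ _ ((`|x| + 1) * `|y - z|)).
  by rewrite ler_wpM2r// lerDl.
rewrite -ltr_pdivlMl//; near: z.
by apply: cvgr_dist_lt; [exact: cvg_id|rewrite mulr_gt0// invr_gt0].
Unshelve. all: by end_near. Qed.

End braket_theory.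

Section basis_theory.
Variables (R : realType) (V : hilbertType R).

Lemma dense_hspan_closed (I : Type) (b : I -> V) (S : set V) :
  dense (hspan b) -> closed S -> S 0 ->
  (forall a i x, S x -> S (a *: b i + x)) -> forall x, S x.
Proof.
move=> bd Scl S0 SD x; apply: contrapT => Sx.
have [] := bd (~` S); first by exists x.
  exact: closed_openC.
move=> z /= [nS [s zs]]; apply: nS; rewrite {}zs.
elim: s => [|p s IH]; first by rewrite big_nil.
by rewrite big_cons; exact: SD.
Qed.

Lemma linear_hspan_eq (W : hilbertType R) (I : Type) (b : I -> V)
    (f g : V -> W) : dense (hspan b) -> linear f -> linear g ->
  continuous f -> continuous g -> (forall i, f (b i) = g (b i)) -> forall x, f x = g x.
Proof.
move=> bd fl gl fc gc fg x.
have l0 (h : V -> W) : linear h -> h 0 = 0.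
  by move=> hl; rewrite -[in LHS](addNr 0) -scaleN1r hl scaleN1r addNr.
apply/eqP; rewrite -subr_eq0; apply/eqP.
move: x; apply: (dense_hspan_closed bd (S := [set x | f x - g x = 0])).
- have -> : [set x | f x - g x = 0] = (fun x => f x - g x) @^-1` [set 0] by [].
  apply: preimage_closed; last exact/accessible_closed_set1/hausdorff_accessible/norm_hausdorff.
  by move=> x _; apply: cvgB; [exact: fc|exact: gc].
- by rewrite /= !l0// subrr.
- move=> a i x /= fgx.
  by rewrite fl gl fg opprD addrACA subrr add0r.
Qed.

Variables (I : choiceType) (b : I -> V).

Local Notation proj A x := (\sum_(i <- enum_fset A) braket (b i) x *: b i).

Lemma braket_proj (bo : forall i j, braket (b i) (b j) = (i == j)%:R)
  (A : {fset I}) x j : braket (b j) (proj A x) =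
  if j \in A then braket (b j) x else 0.
Proof.
rewrite braket_sumr; case: ifPn => jA.
  rewrite (bigD1_seq j) ?fset_uniq//= braketZr bo eqxx mulr1 big1 ?addr0//.
  by move=> i ij; rewrite braketZr bo eq_sym (negbTE ij) mulr0.
rewrite big_seq big1// => i iA; rewrite braketZr bo.
by case: eqP => [ji|_]; [rewrite ji iA in jA|rewrite mulr0].
Qed.

Lemma norm_proj_compl (bo : forall i j, braket (b i) (b j) = (i == j)%:R)
  (A : {fset I}) x : `|x - proj A x| <= `|x|.
Proof.
suff : `|x - proj A x| ^+ 2 <= `|x| ^+ 2 by rewrite ler_pXn2r// nnegrE.
have h : braket (proj A x) (x - proj A x) = 0.
  rewrite braket_suml big_seq big1// => i iA.
  by rewrite braketZl braketBr braket_proj// iA subrr mulr0.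
have -> : `|x| ^+ 2 = `|x - proj A x| ^+ 2 + `|proj A x| ^+ 2.
  have gen (z p : V) : braket p z = 0 ->
      braket (z + p) (z + p) = braket z z + braket p p.
    move=> pz; rewrite braketDl !braketDr pz add0r.
    by rewrite -(braketC p z) pz conjC0 addr0.
  by rewrite -!braketxx -(gen _ _ h) subrK.
by rewrite lerDl exprn_ge0.
Qed.

Lemma hilbert_fourier (bb : orthonormal_basis b) (x : V) :
  proj A x @[A --> totally] --> x.
Proof.
case: bb => bo bd; apply/cvgrPdist_lt => eps eps0.
have [] := bd (ball x eps).
- by exists x; exact: ballxx.
- exact: ball_open.
move=> y [xy [s ys]]; rewrite -ball_normE /= in xy.
exists [fset p.2 | p in s]%fset => // A /= sA.
have yA : proj A y = y.
  have -> : proj A y = \sum_(p <- s) p.1 *: proj A (b p.2).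
    transitivity (\sum_(i <- enum_fset A) \sum_(p <- s)
        (p.1 * braket (b i) (b p.2)) *: b i).
      apply: eq_bigr => i _; rewrite ys braket_sumr scaler_suml.
      by apply: eq_bigr => p _; rewrite braketZr.
    rewrite exchange_big /=; apply: eq_bigr => p _.
    by rewrite scaler_sumr; apply: eq_bigr => i _; rewrite scalerA.
  rewrite ys !big_seq; apply: eq_bigr => p ps; congr (_ *: _).
  have pA : p.2 \in A.
    by apply: (fsubsetP sA); apply/imfsetP; exists p.
  rewrite (bigD1_seq p.2) ?fset_uniq//= bo eqxx scale1r big1 ?addr0//.
  by move=> i ip; rewrite bo (negbTE ip) scale0r.
have -> : x - proj A x = (x - y) - proj A (x - y).
  have -> : proj A (x - y) = proj A x - proj A y.
    by rewrite -sumrB; apply: eq_bigr => i _; rewrite braketBr scalerBl.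
  by rewrite yA opprB addrA subrK.
by apply: (le_lt_trans (norm_proj_compl bo _ _)).
Qed.

Lemma trace_ketbra (x : V) (A : {linear V -> V}) :
  orthonormal_basis b -> continuous A ->
  trace b (ketbra x \o A) = braket x (A x).
Proof.
move=> bb Ac; rewrite /trace /summability.sum; apply: (@cvg_lim R[i]^o).
  exact: norm_hausdorff.
have Ax : {for x, continuous (fun z => braket x (A z) : R[i]^o)}.
  apply: (@continuous_comp _ _ _ A (braket x : V -> R[i]^o)); first exact: Ac.
  exact: braket_continuousr.
have := cvg_comp _ _ (@hilbert_fourier bb x) Ax.
apply: cvg_trans; apply: near_eq_cvg; near=> B => /=.
rewrite linear_sum braket_sumr /partial_sum /=.
rewrite big_seq_fsetE /=; apply: eq_bigr => i _.
by rewrite linearZ braketZr /ketbra /= braketZr mulrC.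
Unshelve. all: by end_near. Qed.

End basis_theory.

(* An n-fold Hilbert-space tensor power of H, with [tmul v] standing for
   v_0 (x) ... (x) v_(n-1); these clauses determine it up to unitary
   equivalence. *)
Record tensor_power (R : realType) (H : hilbertType R) (n : nat) :=
  TensorPower {
    tp_space :> hilbertType R;
    tmul : ('I_n -> H) -> tp_space;
    tmul_linear : forall i (v : 'I_n -> H), linear (fun x : H => tmul (dfwith v i x));
    tmul_braket : forall v w,
      braket (tmul v) (tmul w) = \prod_(i < n) braket (v i) (w i);
    tmul_dense : dense (hspan tmul) }.

Arguments tmul {R H n} t v : rename.

Definition tensor_basis (R : realType) (H : hilbertType R) (n : nat)
    (K : tensor_power H n) (e : nat -> H) : {ffun 'I_n -> nat} -> K :=
  fun J => tmul K (fun i => e (J i)).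

(* The bounded operator A (x) ... (x) A, chosen by [get]; [tensor_op_ketbra]
   computes it in the case that matters, A = |psi><psi|. *)
Definition tensor_op (R : realType) (H : hilbertType R) (n : nat)
    (K : tensor_power H n) (A : H -> H) : K -> K :=
  get [set B : K -> K | [/\ linear B, continuous B
                         & forall v, B (tmul K v) = tmul K (A \o v)]].

Arguments tensor_op {R H n} K A _ : rename.

Section tensor_theory.
Variables (R : realType) (H : hilbertType R) (n : nat) (K : tensor_power H n).

Lemma tmulZ (a : 'I_n -> R[i]) (v : 'I_n -> H) :
  tmul K (fun i => a i *: v i) = (\prod_(i < n) a i) *: tmul K v.
Proof.
apply/eqP; rewrite -subr_eq0 -normr_eq0 -sqrf_eq0 -braketxx.
rewrite braketBr !braketBl !braketZr !braketZl !tmul_braket.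
have -> : \prod_(i < n) braket (a i *: v i) (a i *: v i) =
    (\prod_(i < n) a i)^* * ((\prod_(i < n) a i) *
     \prod_(i < n) braket (v i) (v i)).
  rewrite rmorph_prod -!big_split /=.
  by apply: eq_bigr => i _; rewrite braketZl braketZr.
have -> : \prod_(i < n) braket (a i *: v i) (v i) =
    (\prod_(i < n) a i)^* * \prod_(i < n) braket (v i) (v i).
  rewrite rmorph_prod -!big_split /=.
  by apply: eq_bigr => i _; rewrite braketZl.
have -> : \prod_(i < n) braket (v i) (a i *: v i) =
    (\prod_(i < n) a i) * \prod_(i < n) braket (v i) (v i).
  by rewrite -big_split /=; apply: eq_bigr => i _; rewrite braketZr.
apply/eqP; ring.
Qed.

Lemma ketbra_continuous (V : hilbertType R) (x : V) : continuous (ketbra x).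
Proof.
move=> y; apply: (@cvgZr_tmp R[i] V V (nbhs y) _ (braket x) (braket x y) x).
exact: braket_continuousr.
Qed.

Lemma ketbra_linear (V : hilbertType R) (x : V) : linear (ketbra x).
Proof.
by move=> a y z; rewrite /ketbra braketDr braketZr scalerDl scalerA.
Qed.

Lemma ketbra_tmul (x : H) (v : 'I_n -> H) :
  ketbra (tmul K (fun=> x)) (tmul K v) = tmul K (ketbra x \o v).
Proof. by rewrite /ketbra tmul_braket -tmulZ. Qed.

Lemma tensor_op_ketbra (x : H) :
  tensor_op K (ketbra x) = ketbra (tmul K (fun=> x)).
Proof.
pose P := [set B : K -> K | [/\ linear B, continuous B
  & forall v, B (tmul K v) = tmul K (ketbra x \o v)]].
have Pk : P (ketbra (tmul K (fun=> x))).
  split; [exact: ketbra_linear|exact: ketbra_continuous|exact: ketbra_tmul].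
have [Bl Bc BE] : P (tensor_op K (ketbra x)) by exact: (getI Pk).
have [kl kc kE] := Pk.
apply/funext; apply: (linear_hspan_eq (@tmul_dense _ _ _ K)) => // v.
by rewrite BE kE.
Qed.

End tensor_theory.

Section tensor_basis_theory.
Variables (R : realType) (H : hilbertType R) (n : nat) (K : tensor_power H n).

Lemma hspan_closure_lin (V : hilbertType R) (I : Type) (b : I -> V) a x y :
  closure (hspan b) x -> closure (hspan b) y -> closure (hspan b) (a *: x + y).
Proof.
move=> cx cy B /nbhs_normP[eps /= eps0 epsB].
have a1 : 0 < `|a| + 1 by rewrite ltr_wpDl.
have [x' [[s x's] xx']] : hspan b `&` ball x (eps / 2 / (`|a| + 1)) !=set0.
  by apply: cx; apply: nbhsx_ballx; rewrite !divr_gt0.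
have [y' [[t y't] yy']] : hspan b `&` ball y (eps / 2) !=set0.
  by apply: cy; apply: nbhsx_ballx; rewrite divr_gt0.
exists (a *: x' + y'); split.
  exists ([seq (a * p.1, p.2) | p <- s] ++ t).
  rewrite big_cat big_map /= x's y't scaler_sumr; congr (_ + _).
  by apply: eq_bigr => p _; rewrite scalerA.
apply: epsB; rewrite /ball_ /=.
move: xx' yy'; rewrite -!ball_normE /= ltr_pdivlMr// => xx' yy'.
rewrite opprD addrACA -scalerBr (splitr eps).
rewrite (le_lt_trans (ler_normD _ _))// ltrD// normrZ.
apply: le_lt_trans xx'; rewrite mulrC ler_wpM2l//.
by rewrite lerDl.
Qed.

Lemma hspan_sub_closure (V : hilbertType R) (I : Type) (b : I -> V) i :
  closure (hspan b) (b i).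
Proof.
by apply: subset_closure; exists [:: (1, i)]; rewrite big_seq1 scale1r.
Qed.

Lemma hspan_closure0 (V : hilbertType R) (I : Type) (b : I -> V) :
  closure (hspan b) 0.
Proof. by apply: subset_closure; exists [::]; rewrite big_nil. Qed.

Lemma norm_tmul (v : 'I_n -> H) : `|tmul K v| = \prod_(i < n) `|v i|.
Proof.
apply/eqP; rewrite -(@eqrXn2 _ 2)//; last by rewrite prodr_ge0.
rewrite -braketxx tmul_braket -prodrXl; apply/eqP.
by apply: eq_bigr => i _; rewrite braketxx.
Qed.

Lemma tmul_continuous (i : 'I_n) (v : 'I_n -> H) :
  continuous (fun x : H => tmul K (dfwith v i x)).
Proof.
move=> x; apply/cvgrPdist_lt => eps eps0.
have tB y z : tmul K (dfwith v i y) - tmul K (dfwith v i z) =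
    tmul K (dfwith v i (y - z)).
  have := @tmul_linear _ _ _ K i v (-1) z y.
  by rewrite /= !scaleN1r addrC => <-; rewrite addrC.
pose C : R[i] := \prod_(j < n | j != i) `|v j|.
have C0 : 0 <= C by rewrite prodr_ge0.
have C1 : 0 < C + 1 by rewrite ltr_wpDl.
have tN y : `|tmul K (dfwith v i y)| = `|y| * C.
  rewrite norm_tmul (bigD1 i)//= dfwithin; congr (_ * _).
  by apply: eq_bigr => j ji; rewrite dfwithout// eq_sym.
near=> y; rewrite tB tN (@le_lt_trans _ _ (`|x - y| * (C + 1)))//.
  by rewrite ler_wpM2l// lerDl.
rewrite -ltr_pdivlMr//; near: y.
by apply: cvgr_dist_lt; [exact: cvg_id|rewrite divr_gt0].
Unshelve. all: by end_near. Qed.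

Lemma tensor_basisP (e : nat -> H) :
  orthonormal_basis e -> orthonormal_basis (tensor_basis K e).
Proof.
move=> [eo ed]; split=> [J J'|].
  rewrite tmul_braket; under eq_bigr do rewrite eo.
  have [->|JJ'] := eqVneq J J'; first by rewrite big1// => i _; rewrite eqxx.
  have /existsP[i Ji] : [exists i, J i != J' i].
    apply: contra_neqT JJ' => /existsPn h; apply/ffunP => i.
    by apply/eqP; rewrite -[_ == _]negbK.
  by rewrite (bigD1 i)//= (negbTE Ji) mul0r.
pose tb := tensor_basis K e.
have step k : forall v, (forall i : 'I_n, (k <= i)%N -> exists j, v i = e j) ->
    closure (hspan tb) (tmul K v).
  elim: k => [|k IH] v vk.
    have {vk}/choice[J vJ] : forall i : 'I_n, exists j, v i = e j by move=> i; exact: vk.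
    have -> : tmul K v = tb [ffun i => J i].
      by congr tmul; apply/funext => i; rewrite ffunE vJ.
    exact: hspan_sub_closure.
  have [nk|kn] := leqP n k.
    by apply: IH => i /(leq_trans nk); rewrite leqNgt ltn_ord.
  pose i0 := Ordinal kn.
  have -> : v = dfwith v i0 (v i0).
    by apply/funext => i; case: dfwithP.
  move: (v i0) => x.
  pose S := [set x : H | closure (hspan tb) (tmul K (dfwith v i0 x))].
  have tl := @tmul_linear _ _ _ K i0 v.
  apply: (dense_hspan_closed (S := S) ed); rewrite /S.
  - apply: (@preimage_closed _ _ (fun x : H => tmul K (dfwith v i0 x))).
      by move=> z _; exact: tmul_continuous.
    exact: closed_closure.
  - have := tl (-1) 0 0; rewrite !scaleN1r !addNr /= => ->.
    exact: hspan_closure0.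
  - move=> a j y /= yS; rewrite tl; apply: hspan_closure_lin => //.
    apply: IH => i; case: dfwithP => [_|i' i'i0 ki]; first by exists j.
    apply: vk; rewrite ltn_neqAle ki andbT.
    by apply: contra i'i0 => /eqP ki'; apply/eqP/val_inj.
have cl x : closure (hspan tb) x.
  apply: (dense_hspan_closed (@tmul_dense _ _ _ K) (S := closure (hspan tb))).
  - exact: closed_closure.
  - exact: hspan_closure0.
  - move=> a v y; apply: hspan_closure_lin.
    by apply: (step n) => i; rewrite leqNgt ltn_ord.
move=> O [x Ox] Oo; rewrite setIC; apply: (cl x).
by apply: open_nbhs_nbhs; split.
Qed.

End tensor_basis_theory.

(* Only the values at measurable sets matter; as for the library's measures,
   positivity (and boundedness) is imposed at every set. [povm_sigma_additive]
   is sigma-additivity in the weak operator topology. *)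
Record povm d (T : measurableType d) (R : realType) (V : hilbertType R) :=
  Povm {
    povm_op :> set T -> {linear V -> V};
    povm_continuous : forall E, continuous (povm_op E);
    povm_ge0 : forall E x, 0 <= braket x (povm_op E x);
    povm_sigma_additive : forall F : (set T)^nat,
      (forall i, measurable (F i)) -> trivIset setT F ->
      forall x y, (\sum_(i < k) braket x (povm_op (F i) y) : R[i]^o)
        @[k --> \oo] --> (braket x (povm_op (\bigcup_i F i) y) : R[i]^o);
    povm_setT : forall x, povm_op setT x = x }.

Record hilbertBasis (R : realType) (H : hilbertType R) := HilbertBasis {
  hilbert_basis :> nat -> H;
  hilbert_basisP : orthonormal_basis hilbert_basis }.

Section born.
Context d (T : measurableType d) (R : realType) (H : hilbertType R).
Variables (e : hilbertBasis H) (n : nat) (K : tensor_power H n).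
Variables (M : povm T K) (psi : H).

(* Law of the outcome, E |-> Tr(|psi><psi|^(x)n M(E)); a probability measure for
   unit [psi], see [born_setT]. The trace is real; it is evaluated in the product basis of [e]. *)
Definition born (E : set T) : \bar R :=
  (complex.Re (trace (tensor_basis K e) (tensor_op K (ketbra psi) \o M E)))%:E.

Local Notation psin := (tmul K (fun=> psi)).

Lemma trace_state (E : set T) :
  trace (tensor_basis K e) (tensor_op K (ketbra psi) \o M E) =
  braket psin (M E psin).
Proof.
rewrite tensor_op_ketbra; apply: trace_ketbra; last exact: povm_continuous.
exact/tensor_basisP/hilbert_basisP.
Qed.

Lemma cvg_Re (u : (R[i])^nat) (l : R[i]) :
  (u k : R[i]^o) @[k --> \oo] --> (l : R[i]^o) ->
  complex.Re (u k) @[k --> \oo] --> complex.Re l.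
Proof.
move=> /cvgrPdist_lt ul; apply/cvgrPdist_lt => eps eps0.
have := ul eps%:C%C; rewrite ltcR => /(_ eps0); apply: filterS => k.
rewrite -raddfB -ltcR; apply: le_lt_trans.
exact: normc_ge_Re.
Qed.

Let born0 : born set0 = 0%E.
Proof.
rewrite /born trace_state.
have := @povm_sigma_additive _ _ _ _ M (fun=> set0) (fun=> measurable0)
  (@trivIset_set0 _ _ _) psin psin.
rewrite bigcup0// => /cvg_Re; set c := complex.Re _ => ul.
have u1 : complex.Re (\sum_(i < k.+1) braket psin (M set0 psin))
    @[k --> \oo] --> c.
  by rewrite (cvg_shiftS (fun k => complex.Re
    (\sum_(i < k) braket psin (M set0 psin)))).
have : (fun=> c) @ \oo --> (c - c : R).
  apply: cvg_trans (cvgB u1 ul); apply: near_eq_cvg; near=> k => /=.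
  by rewrite !fctE big_ord_recr raddfD /= addrAC subrr add0r.
by rewrite subrr => /cvg_lim; rewrite lim_cst// => ->.
Unshelve. all: by end_near. Qed.

Let born_ge0 E : (0 <= born E)%E.
Proof.
rewrite /born trace_state lee_fin.
by have := povm_ge0 M E psin; rewrite lecE => /andP[].
Qed.

Let born_additive : semi_sigma_additive born.
Proof.
move=> F mF tF _; rewrite /born.
have := cvg_Re (@povm_sigma_additive _ _ _ _ M F mF tF psin psin).
rewrite -trace_state => h.
rewrite (_ : (fun k => _) = EFin \o (fun k => complex.Re
    (\sum_(i < k) braket psin (M (F i) psin)))); last first.
  apply/funext => k /=; rewrite sumEFin big_mkord; congr (_%:E).
  rewrite raddf_sum.
  by apply: eq_bigr => i _; rewrite -trace_state.
by apply: cvg_EFin h; near=> k.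
Unshelve. all: by end_near. Qed.

HB.instance Definition _ :=
  isMeasure.Build d T R born born0 born_ge0 born_additive.

Lemma born_setT : `|psi| = 1 -> born setT = 1%E.
Proof.
move=> psi1; rewrite /born trace_state povm_setT braketxx norm_tmul.
by rewrite psi1 big1// expr1n.
Qed.

End born.

Section model.
Variables (R : realType) (H : hilbertType R) (e : hilbertBasis H).

(* For [s > 0] the [j = 0] term vanishes, since [0 `^ (2 * s) = 0]. *)
Definition weighted_sum (s : R) (psi : H) : \bar R :=
  (\sum_(0 <= j <oo)
    (complex.Re (`|braket (e j) psi| ^+ 2) * j%:R `^ (2 * s))%:E)%E.

Definition hermite_sobolev (alpha L : R) : set (H -> H) :=
  [set ketbra psi | psi in
    [set psi | `|psi| = 1 /\ (weighted_sum alpha psi <= L%:E)%E]].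

(* The sum is finite on [hermite_sobolev alpha L] when [beta < alpha]. *)
Definition Ffun (beta : R) (psi : H) : R := fine (weighted_sum beta psi).

Definition mean_square_error (beta : R) (n : nat) (K : tensor_power H n)
    d (T : measurableType d) (M : povm T K) (Fhat : {mfun T >-> R})
    (psi : H) : \bar R :=
  \int[born e M psi]_x ((Fhat x - Ffun beta psi) ^+ 2)%:E.

End model.

Definition eta_sq (R : realType) (alpha beta : R) (n : nat) : R :=
  if 2 * beta <= alpha then n%:R^-1 else n%:R `^ (- (2 * (1 - beta / alpha))).

Definition scaled_minimax_risk (R : realType) (alpha beta L : R)
    (H : hilbertType R) (e : hilbertBasis H) (n : nat)
    (K : tensor_power H n) : \bar R :=
  ereal_inf [set r | exists (d : measure_display) (T : measurableType d)
      (M : povm T K) (Fhat : {mfun T >-> R}),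
    r = ereal_sup [set ((eta_sq alpha beta n)^-1%:E *
                         mean_square_error e beta M Fhat psi)%E
                  | psi in [set psi | hermite_sobolev e alpha L (ketbra psi)]]].

(* Main.v *)
(* Le Cam's two-point method. For two unit vectors x, y of the n-fold tensor
   power, Cauchy-Schwarz for the positive forms <.|M(A).> and <.|M(~` A).> shows
   that the error probabilities of any test sum to at least <x|y>^2 / 2, so an
   estimator errs by half of the gap between F(psi0) and F(psi1) with probability
   bounded below as soon as |<psi0|psi1>|^(2n) is. Both rates come
   from the vectors sqrt(1 - p) e_0 + sqrt(p) e_N, where F = p N^(2 beta):
   for alpha >= 2 beta take N = 1 and two values of p that are n^(-1/2) apart;
   for alpha < 2 beta take p = 0 and p = 1 / (2n) with N as large as the
   constraint p N^(2 alpha) <= L permits, N ~ n^(1 / (2 alpha)). *)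
Require Import Defs.
From mathcomp Require Import all_boot all_order all_algebra.
From mathcomp Require Import complex.
From mathcomp Require Import all_classical all_reals all_analysis.
From mathcomp Require Import measurable_realfun.
From mathcomp Require Import ring lra.

Import Order.TTheory GRing.Theory Num.Theory.
Import numFieldNormedType.Exports.

Local Open Scope classical_set_scope.
Local Open Scope ring_scope.

(** * Measurement effects of the empty set and of complements *)

Lemma povm_set0 d (T : measurableType d) (R : realType) (V : hilbertType R)
    (M : povm T V) (x y : V) : braket x (M set0 y) = 0.
Proof.
have := @povm_sigma_additive _ _ _ _ M (fun=> set0) (fun=> measurable0)
  (@trivIset_set0 _ _ _) x y.
rewrite bigcup0//; set c := braket _ _ => ul.
(* The series is constant with term [c] and converges, so [c], the difference of consecutive partial
   sums, tends to 0. *)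
have u1 : (\sum_(i < k.+1) c : R[i]^o) @[k --> \oo] --> (c : R[i]^o).
  by rewrite (cvg_shiftS (fun k => \sum_(i < k) c : R[i]^o)).
have : (fun=> c : R[i]^o) @ \oo --> (c - c : R[i]^o).
  apply: cvg_trans (cvgB u1 ul); apply: near_eq_cvg; near=> k => /=.
  by rewrite !fctE big_ord_recr /= addrAC subrr add0r.
rewrite subrr => /cvg_lim; rewrite lim_cst//; first by apply; exact: norm_hausdorff.
Unshelve. all: by end_near. Qed.

Lemma povm_setC d (T : measurableType d) (R : realType) (V : hilbertType R)
    (M : povm T V) (A : set T) (x y : V) : measurable A ->
  braket x (M A y) + braket x (M (~` A) y) = braket x y.
Proof.
move=> mA; pose F : (set T)^nat := bigcup2 A (~` A).
have mF i : measurable (F i).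
  by rewrite /F; case: i => [//|[|i]]/=; [exact: measurableC|exact: measurable0].
have tF : trivIset setT F.
  by rewrite /F -trivIset_bigcup2 setICr.
have := @povm_sigma_additive _ _ _ _ M F mF tF x y.
rewrite bigcup2E setUCr povm_setT => h.
have : (fun=> braket x (M A y) + braket x (M (~` A) y) : R[i]^o) @ \oo -->
    (braket x y : R[i]^o).
  apply: cvg_trans h; apply: near_eq_cvg; exists 2%N => // -[//|[//|k]] _.
  rewrite /= 2!big_ord_recl big1 ?addr0//= => i _.
  exact: povm_set0.
move=> /cvg_lim; rewrite lim_cst//; first by apply; exact: norm_hausdorff.
Qed.

Lemma conj_realC (R : realType) (a : R) : (a%:C%C : R[i])^* = a%:C%C.
Proof. exact: conjc_real. Qed.

(** * Testing between two vectors *)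

Section test.
Context d (T : measurableType d) (R : realType) (V : hilbertType R).
Variable M : povm T V.

Local Notation prob E x := (complex.Re (braket x (M E x))).
Local Notation cross E x y :=
  (complex.Re (braket x (M E y)) + complex.Re (braket y (M E x))).

Lemma povm_prob_ge0 (E : set T) (x : V) : 0 <= prob E x.
Proof. by have := povm_ge0 M E x; rewrite lecE => /andP[]. Qed.

(** Positivity of [M E] at the vector [s x - t y], expanded. *)
Lemma povm_cross_le (E : set T) (x y : V) (s t : R) :
  s * t * cross E x y <= s ^+ 2 * prob E x + t ^+ 2 * prob E y.
Proof.
have ReZ (a : R) (c : R[i]) : complex.Re (a%:C%C * c) = a * complex.Re c.
  by case: c => u v /=; rewrite mul0r subr0.
have := povm_prob_ge0 E (s%:C%C *: x + (- t)%:C%C *: y).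
rewrite linearD !linearZ /= braketDr !braketDl !braketZr !braketZl.
rewrite !conj_realC !raddfD /= !ReZ.
lra.
Qed.

(* The right-hand side is the sum of the error probabilities of the test that
   decides for [x] on [A]; the bound comes from <s x - y|M(A)(s x - y)> >= 0 and
   <x - s y|M(~` A)(x - s y)> >= 0 with s = r / 2. *)
Lemma povm_test_error (A : set T) (x y : V) (r : R) : measurable A ->
  `|x| = 1 -> `|y| = 1 -> braket x y = r%:C%C ->
  r ^+ 2 / 2 <= prob (~` A) x + prob A y.
Proof.
move=> mA x1 y1 xy.
have yx : braket y x = r%:C%C by rewrite -braketC xy conj_realC.
have ReA (u v : V) : complex.Re (braket u (M A v)) +
    complex.Re (braket u (M (~` A) v)) = complex.Re (braket u v).
  by rewrite -raddfD /= povm_setC.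
have := povm_cross_le A x y (r / 2) 1.
have := povm_cross_le (~` A) x y 1 (r / 2).
have := ReA x y; have := ReA y x; have := ReA x x; have := ReA y y.
rewrite xy yx !braketxx x1 y1 expr1n /=.
have := povm_prob_ge0 A y; have := povm_prob_ge0 (~` A) x.
set a := prob A x; set a' := prob (~` A) x.
set b := prob A y; set b' := prob (~` A) y => a'0 b0 bb aa.
set p := complex.Re _; set p' := complex.Re _ => pp.
set q := complex.Re _; set q' := complex.Re _ => qq.
have -> : b' = 1 - b by lra.
have -> : a = 1 - a' by lra.
have -> : p' = r - p by lra.
have -> : q' = r - q by lra.
(* The two cross inequalities add up to [r^2 / 2 <= (1 - r^2 / 4) (a' + b)]; these two facts allow
   the factor to be replaced by 1. *)
have : 0 <= r ^+ 2 * a' by rewrite mulr_ge0// sqr_ge0.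
have : 0 <= r ^+ 2 * b by rewrite mulr_ge0// sqr_ge0.
nra.
Qed.

End test.

(** * From testing to estimation *)

Section two_points.
Context (R : realType) (H : hilbertType R) (e : hilbertBasis H) (n : nat).
Context (K : tensor_power H n).

Local Notation psin psi := (tmul K (fun=> psi)).

(** Markov's argument: the integral is restricted to [E], whose Born probability is the quadratic
    form of [M E]. *)
Lemma mean_square_error_ge (beta : R) d (T : measurableType d) (M : povm T K)
    (Fhat : {mfun T >-> R}) (psi : H) (E : set T) (m : R) :
  measurable E -> (forall x, E x -> m <= (Fhat x - Ffun e beta psi) ^+ 2) ->
  0 <= m ->
  ((m * complex.Re (braket (psin psi) (M E (psin psi))))%:E <=
   mean_square_error e beta M Fhat psi)%E.
Proof.
move=> mE Em m0; rewrite /mean_square_error.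
have mf : measurable_fun setT
    (EFin \o (fun x => (Fhat x - Ffun e beta psi) ^+ 2)).
  apply/measurable_EFinP; apply: measurable_funX.
  exact: measurable_funB.
rewrite EFinM -(trace_state e) -/(born e M psi E) -integral_cst//.
apply: (@le_trans _ _
    (\int[born e M psi]_(x in E) ((Fhat x - Ffun e beta psi) ^+ 2)%:E)%E).
  apply: ge0_le_integral => //.
  - exact: measurable_funS mf.
by apply: ge0_subset_integral => // x _; rewrite lee_fin sqr_ge0.
Qed.

(* The test decides whether [Fhat] is below the midpoint of the two values. *)
Lemma two_point_mean_square_error (beta r : R) d (T : measurableType d)
    (M : povm T K) (Fhat : {mfun T >-> R}) (psi0 psi1 : H) :
  `|psi0| = 1 -> `|psi1| = 1 -> braket psi0 psi1 = r%:C%C ->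
  Ffun e beta psi0 <= Ffun e beta psi1 ->
  exists2 psi, psi = psi0 \/ psi = psi1 &
  (((Ffun e beta psi1 - Ffun e beta psi0) ^+ 2 * (r ^+ 2) ^+ n / 16)%:E <=
   mean_square_error e beta M Fhat psi)%E.
Proof.
set F0 := Ffun e beta psi0; set F1 := Ffun e beta psi1 => n0 n1 ov F01.
pose mid := (F0 + F1) / 2.
pose A := Fhat @^-1` `]-oo, mid].
have mA : measurable A.
  by rewrite /A -[_ @^-1` _]setTI; exact: measurable_funPT.
have err := @povm_test_error _ _ _ _ M A (psin psi0) (psin psi1) (r ^+ n) mA.
have ovn : braket (psin psi0) (psin psi1) = (r ^+ n)%:C%C.
  by rewrite tmul_braket ov prodr_const card_ord rmorphXn.
have {err ovn} := err _ _ ovn; rewrite !norm_tmul n0 n1 !big1// => /(_ erefl erefl).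
set p0 := complex.Re _; set p1 := complex.Re _ => err.
have D0 : 0 <= ((F1 - F0) / 2) ^+ 2 by exact: sqr_ge0.
have E0 : ((((F1 - F0) / 2) ^+ 2 * p0)%:E <=
    mean_square_error e beta M Fhat psi0)%E.
  apply: mean_square_error_ge => //; first exact: measurableC.
  move=> x; rewrite /A /= in_itv /= => /negP; rewrite -ltNge => /ltW xm.
  by rewrite -/F0 ler_pXn2r// ?nnegrE; rewrite /mid in xm; lra.
have E1 : ((((F1 - F0) / 2) ^+ 2 * p1)%:E <=
    mean_square_error e beta M Fhat psi1)%E.
  apply: mean_square_error_ge => // x; rewrite /A /= in_itv /= => xm.
  rewrite -/F1 -[leRHS]sqrrN ler_pXn2r// ?nnegrE; rewrite /mid in xm; lra.
(* A factor 4 comes from squaring half the gap. The other comes from the error probabilities: they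
   sum to at least [r^(2n) / 2], so one of them is at least [r^(2n) / 4]. *)
have -> : (F1 - F0) ^+ 2 * (r ^+ 2) ^+ n / 16 =
    ((F1 - F0) / 2) ^+ 2 * ((r ^+ n) ^+ 2 / 4).
  by rewrite exprAC; lra.
have [p0r|p0r] := leP ((r ^+ n) ^+ 2 / 4) p0; [exists psi0|exists psi1].
- by left.
- by apply: le_trans E0; rewrite lee_fin ler_wpM2l.
- by right.
- by apply: le_trans E1; rewrite lee_fin ler_wpM2l//; lra.
Qed.

(** The bad state depends on the measurement and estimator, but both candidates lie in the class, so
    the supremum dominates either one and the bound passes to the infimum. *)
Lemma scaled_minimax_risk_ge (alpha beta L r : R) (psi0 psi1 : H) :
  hermite_sobolev e alpha L (ketbra psi0) ->
  hermite_sobolev e alpha L (ketbra psi1) ->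
  `|psi0| = 1 -> `|psi1| = 1 -> braket psi0 psi1 = r%:C%C ->
  Ffun e beta psi0 <= Ffun e beta psi1 ->
  (((eta_sq alpha beta n)^-1 *
     ((Ffun e beta psi1 - Ffun e beta psi0) ^+ 2 * (r ^+ 2) ^+ n / 16))%:E <=
    scaled_minimax_risk alpha beta L e K)%E.
Proof.
move=> S0 S1 n0 n1 ov F01; apply: le_ereal_inf_tmp => _ [d [T [M [Fhat ->]]]].
have [psi psiE le] := @two_point_mean_square_error beta r _ _ M Fhat _ _ n0 n1 ov F01.
apply: (@le_trans _ _
  ((eta_sq alpha beta n)^-1%:E * mean_square_error e beta M Fhat psi)%E).
  rewrite EFinM lee_wpmul2l// lee_fin invr_ge0 /eta_sq.
  by case: ifP => // _; exact: powR_ge0.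
by apply: ereal_sup_ubound; exists psi => //; case: psiE => ->.
Qed.

End two_points.

(** * Superpositions of level 0 and level [N] *)

Section two_level.
Context (R : realType) (H : hilbertType R) (e : hilbertBasis H) (N : nat).

Definition two_level (p : R) : H :=
  (Num.sqrt (1 - p))%:C%C *: e 0%N + (Num.sqrt p)%:C%C *: e N.

Hypothesis N0 : (0 < N)%N.

Let eE i j : braket (e i) (e j) = (i == j)%:R.
Proof. by case: (hilbert_basisP e). Qed.

Lemma braket_basis_two_level (p : R) (j : nat) : braket (e j) (two_level p) =
  (if j == 0%N then Num.sqrt (1 - p) else if j == N then Num.sqrt p else 0)%:C%C.
Proof.
rewrite /two_level braketDr !braketZr !eE.
case: (eqVneq j 0%N) => [->|j0].
  by rewrite eq_sym gt_eqF// mulr1 mulr0 addr0.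
by rewrite mulr0 add0r; case: (eqVneq j N) => _; rewrite ?mulr1 ?mulr0.
Qed.

Lemma braket_two_level (p q : R) : braket (two_level p) (two_level q) =
  (Num.sqrt (1 - p) * Num.sqrt (1 - q) + Num.sqrt p * Num.sqrt q)%:C%C.
Proof.
rewrite {1}/two_level braketDl !braketZl !conj_realC !braket_basis_two_level.
by rewrite !eqxx gtn_eqF// rmorphD !rmorphM.
Qed.

Lemma norm_two_level (p : R) : 0 <= p <= 1 -> `|two_level p| = 1.
Proof.
move=> /andP[p0 p1]; apply/eqP; rewrite -(@eqrXn2 _ 2)// -braketxx expr1n.
by rewrite braket_two_level -!expr2 !sqr_sqrtr ?subr_ge0// subrK.
Qed.

Lemma weighted_sum_two_level (s p : R) : 0 < s -> 0 <= p ->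
  weighted_sum e s (two_level p) = (p * N%:R `^ (2 * s))%:E.
Proof.
move=> s0 p0; rewrite /weighted_sum.
pose c k := if k == 0%N then Num.sqrt (1 - p)
            else if k == N then Num.sqrt p else 0.
rewrite (@eq_eseriesr _ _ (fun k => (c k ^+ 2 * k%:R `^ (2 * s))%:E)); last first.
  move=> k _; rewrite braket_basis_two_level normCK conj_realC -rmorphM.
  by rewrite -expr2.
rewrite (@nneseriesD1 R _ N)//; last first.
  by move=> k _; rewrite lee_fin mulr_ge0 ?powR_ge0 ?sqr_ge0.
rewrite eseries0 ?adde0 => [|k _ kN].
  by rewrite /c gtn_eqF// eqxx sqr_sqrtr.
rewrite /c (negbTE kN : (k == N) = false).
case: (eqVneq k 0%N) => [->|_] /=; last by rewrite expr0n mul0r.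
by rewrite mulr0n powR0 ?mulr0// mulf_neq0// gt_eqF.
Qed.

Lemma Ffun_two_level (s p : R) : 0 < s -> 0 <= p ->
  Ffun e s (two_level p) = p * N%:R `^ (2 * s).
Proof. by move=> s0 p0; rewrite /Ffun weighted_sum_two_level. Qed.

Lemma hermite_sobolev_two_level (s L p : R) : 0 < s -> 0 <= p <= 1 ->
  p * N%:R `^ (2 * s) <= L ->
  hermite_sobolev e s L (ketbra (two_level p)).
Proof.
move=> s0 p01 pL; exists (two_level p) => //; split; first exact: norm_two_level.
by case/andP: p01 => p0 _; rewrite weighted_sum_two_level// lee_fin.
Qed.

Lemma two_level_minimax_risk_ge (alpha beta L p q : R) (n : nat)
    (K : tensor_power H n) : 0 < alpha -> 0 < beta -> 0 <= p -> p <= q ->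
  q <= 1 -> q * N%:R `^ (2 * alpha) <= L ->
  (((eta_sq alpha beta n)^-1 * (((q - p) * N%:R `^ (2 * beta)) ^+ 2 *
    ((Num.sqrt (1 - p) * Num.sqrt (1 - q) + Num.sqrt p * Num.sqrt q) ^+ 2) ^+ n
      / 16))%:E <= scaled_minimax_risk alpha beta L e K)%E.
Proof.
move=> a0 b0 p0 pq q1 qL.
have q0 : 0 <= q by lra.
have p1 : p <= 1 by lra.
rewrite mulrBl -!Ffun_two_level//; apply: scaled_minimax_risk_ge.
- apply: hermite_sobolev_two_level => //; first by rewrite p0.
  by apply: le_trans qL; rewrite ler_wpM2r// powR_ge0.
- by apply: hermite_sobolev_two_level => //; rewrite q0.
- by apply: norm_two_level; rewrite p0.
- by apply: norm_two_level; rewrite q0.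
- exact: braket_two_level.
- by rewrite !Ffun_two_level// ler_wpM2r// powR_ge0.
Qed.

End two_level.

(** * Choice of parameters and the two rates *)

Section rates.
Context (R : realType).

Lemma Bernoulli_inequality (x : R) (n : nat) : 0 <= x <= 1 ->
  1 - n%:R * x <= (1 - x) ^+ n.
Proof.
move=> /andP[x0 x1]; elim: n => [|n IH]; first by rewrite expr0; lra.
rewrite exprS -natr1.
apply: (@le_trans _ _ ((1 - x) * (1 - n%:R * x))).
  have : 0 <= n%:R * (x * x) by rewrite !mulr_ge0.
  nra.
by rewrite ler_wpM2l// subr_ge0.
Qed.

(** The arithmetic mean exceeds the geometric one by [(v - u)^2 / (2 (sqrt u + sqrt v)^2)]. This is
    second order in [v - u], so weights [n^(-1/2)] apart have overlap [1 - O(1/n)]. *)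
Lemma sqrtM_ge_mean (c u v : R) : 0 < c -> c <= u -> c <= v ->
  (u + v) / 2 - (v - u) ^+ 2 / (4 * c) <= Num.sqrt u * Num.sqrt v.
Proof.
move=> c0 cu cv.
have := sqr_sqrtr (ltW (lt_le_trans c0 cu)).
have := sqr_sqrtr (ltW (lt_le_trans c0 cv)).
have := sqrtr_ge0 u; have := sqrtr_ge0 v.
set x := Num.sqrt u; set y := Num.sqrt v => y0 x0 yv xu.
rewrite -{}yv -{}xu in cu cv *.
have xy : 2 * c <= (x + y) ^+ 2.
  have : 0 <= x * y by rewrite mulr_ge0.
  nra.
have -> : (y ^+ 2 - x ^+ 2) ^+ 2 = (x - y) ^+ 2 * (x + y) ^+ 2 by ring.
rewrite lerBlDr -lerBlDl ler_pdivlMr ?mulr_gt0//.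
have -> : ((x ^+ 2 + y ^+ 2) / 2 - x * y) * (4 * c) = (x - y) ^+ 2 * (2 * c).
  by field.
by rewrite ler_wpM2l ?sqr_ge0.
Qed.

Lemma limn_einf_ge (u : (\bar R)^nat) (c : \bar R) :
  (\forall n \near \oo, (c <= u n)%E) -> (c <= limn_einf u)%E.
Proof.
move=> [n0 _ cu]; rewrite limn_einf_lim.
apply: (@le_trans _ _ (einfs u n0)).
  by apply: le_ereal_inf_tmp => _ [m /= nm <-]; exact: cu.
rewrite (cvg_lim _ (@cvg_einfs_sup _ u))//.
by apply: ereal_sup_ubound; exists n0.
Qed.

Lemma parametric_rate (alpha beta L : R) : 0 < beta -> beta < alpha -> 0 < L ->
  2 * beta <= alpha ->
  exists2 c : R, 0 < c &
    forall (H : hilbertType R) (e : hilbertBasis H) (n : nat)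
           (K : tensor_power H n), (0 < n)%N ->
      (c%:E <= scaled_minimax_risk alpha beta L e K)%E.
Proof.
move=> b0 ba L0 b2a.
have a0 : 0 < alpha by lra.
(* Both weights will lie in [[a, 2a]]; this [a] keeps them below [L] and keeps their complements to
   1 above [a]. *)
pose a := Num.min L 1 / 4.
have [aL a1 apos] : [/\ 4 * a <= L, 4 * a <= 1 & 0 < a].
  have -> : 4 * a = Num.min L 1 by rewrite /a; field.
  by rewrite !ge_min !lexx orbT divr_gt0// lt_min L0 ltr01.
exists (a ^+ 2 / 32) => [|H e n K n0]; first by rewrite divr_gt0// exprn_gt0.
have nR : (1 : R) <= n%:R by rewrite ler1n.
have s1 : 1 <= Num.sqrt (n%:R : R) by rewrite -[leLHS]sqrtr1 ler_wsqrtr.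
pose dl := a / Num.sqrt n%:R.
have dl0 : 0 <= dl by rewrite divr_ge0// ltW.
have dla : dl <= a by rewrite ler_pdivrMr; nra.
have dl2 : dl ^+ 2 = a ^+ 2 / n%:R by rewrite expr_div_n sqr_sqrtr.
have := @two_level_minimax_risk_ge _ H e 1 erefl alpha beta L a (a + dl) n K a0 b0.
rewrite !powR1 !mulr1 => /(_ ltac:(lra) ltac:(lra) ltac:(lra) ltac:(lra)).
apply: le_trans; rewrite lee_fin /eta_sq b2a invrK.
set r := Num.sqrt _ * _ + _.
(* The two means add up to 1, and each product of roots loses at most [dl^2 / (4 a) = a / (4 n)]. *)
have hr : 1 - a / (2 * n%:R) <= r.
  have := @sqrtM_ge_mean a a (a + dl) apos ltac:(lra) ltac:(lra).
  have := @sqrtM_ge_mean a (1 - a) (1 - (a + dl)) apos ltac:(lra) ltac:(lra).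
  have -> : 1 - (a + dl) - (1 - a) = - dl by ring.
  have -> : a + dl - a = dl by ring.
  rewrite sqrrN dl2.
  have -> : a ^+ 2 / n%:R / (4 * a) = a / (2 * n%:R) / 2.
    by field; rewrite !gt_eqF//; lra.
  by rewrite /r; lra.
have ha : 0 <= a / n%:R <= a.
  have ale : a <= a * n%:R by rewrite ler_peMr// ltW.
  apply/andP; split; first by apply: divr_ge0; lra.
  by rewrite ler_pdivrMr//; lra.
have r2 : 1 - a / n%:R <= r ^+ 2.
  have an : a / (2 * n%:R) = a / n%:R / 2 by rewrite invfM; lra.
  rewrite an in hr; nra.
have rn : 1 / 2 <= (r ^+ 2) ^+ n.
  apply: (@le_trans _ _ ((1 - a / n%:R) ^+ n)); last first.
    by rewrite lerXn2r// ?nnegrE ?sqr_ge0//; lra.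
  apply: le_trans (@Bernoulli_inequality (a / n%:R) n ltac:(lra)).
  have -> : n%:R * (a / n%:R) = a by rewrite mulrC divfK// gt_eqF//; lra.
  lra.
have -> : n%:R * ((a + dl - a) ^+ 2 * (r ^+ 2) ^+ n / 16) =
  a ^+ 2 * (r ^+ 2) ^+ n / 16.
  have -> : a + dl - a = dl by ring.
  by rewrite dl2; field; rewrite gt_eqF//; lra.
have := @ler_wpM2l _ (a ^+ 2) (sqr_ge0 _) _ _ rn.
lra.
Qed.

Lemma nonparametric_rate (alpha beta L : R) :
  0 < beta -> beta < alpha -> 0 < L -> alpha < 2 * beta ->
  exists2 c : R, 0 < c &
    forall (H : hilbertType R) (e : hilbertBasis H) (n : nat)
           (K : tensor_power H n), 1 <= 2 * n%:R * L ->
      (c%:E <= scaled_minimax_risk alpha beta L e K)%E.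
Proof.
move=> b0 ba L0 b2a.
have a0 : 0 < alpha by lra.
(* The constant left in [q (X / 2)^(2 beta)], for the [q] and [X] below, once the power of [n] is
   split off. *)
pose k := (2^-1) `^ (2 * beta) * (2 * L) `^ (beta / alpha) / 2.
have k0 : 0 < k by rewrite divr_gt0// mulr_gt0// powR_gt0// ?mulr_gt0.
exists (k ^+ 2 / 32) => [|H e n K nL]; first by rewrite divr_gt0// exprn_gt0.
have n0 : (0 < n)%N.
  by case: n nL {K} => // ; rewrite mulr0 mul0r ler10.
have nR : (1 : R) <= n%:R by rewrite ler1n.
(* [X] solves [q X^(2 alpha) = L] for [q = 1 / (2n)]; [1 <= 2 n L] makes its integer part [N] a
   level above 0. *)
pose X := (2 * n%:R * L) `^ (2 * alpha)^-1.
have X1 : 1 <= X.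
  apply: (@le_trans _ _ (1 `^ (2 * alpha)^-1)); first by rewrite powR1.
  by apply: ge0_ler_powR; rewrite ?nnegrE ?invr_ge0//; lra.
pose N := Num.trunc X.
have /andP[NX XN] := truncn_itv (le_trans ler01 X1).
have N0 : (0 < N)%N by rewrite truncn_gt0.
(* Rounding down costs at most a factor 2: [X < N + 1 <= 2 N]. *)
have XN2 : 2^-1 * X <= N%:R.
  have : (1 : R) <= N%:R by rewrite ler1n.
  by rewrite -natr1 in XN; rewrite /N; lra.
pose q : R := (2 * n%:R)^-1.
have q0 : 0 <= q by rewrite invr_ge0; lra.
have q1 : q <= 1 by rewrite invf_le1; lra.
have Na : N%:R `^ (2 * alpha) <= 2 * n%:R * L.
  apply: (@le_trans _ _ (X `^ (2 * alpha))).
    by apply: ge0_ler_powR; rewrite ?nnegrE//; lra.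
  by rewrite /X -powRrM mulVf ?powRr1//; [lra|rewrite gt_eqF//; lra].
have := @two_level_minimax_risk_ge _ H e N N0 alpha beta L 0 q n K a0 b0
  (lexx _) q0 q1.
rewrite /q mulrC ler_pdivrMr; last lra.
rewrite [leRHS]mulrC => /(_ Na).
apply: le_trans; rewrite lee_fin /eta_sq ifF; last by apply/negbTE; rewrite -ltNge.
rewrite !subr0 sqrtr0 sqrtr1 mul0r addr0 mul1r -/q.
(* [w] is [eta_n] itself, so the gap in [F] must be at least [k w]. *)
pose w : R := n%:R `^ (- (1 - beta / alpha)).
have w0 : 0 < w by rewrite powR_gt0; lra.
have -> : n%:R `^ (- (2 * (1 - beta / alpha))) = w ^+ 2.
  rewrite -powR_mulrn ?powR_ge0// -powRrM; congr (_ `^ _); lra.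
have kq : k * w <= q * N%:R `^ (2 * beta).
  apply: (@le_trans _ _ (q * (2^-1 * X) `^ (2 * beta))).
    rewrite powRM ?invr_ge0//; last by lra.
    rewrite /X -powRrM.
    have -> : (2 * alpha)^-1 * (2 * beta) = beta / alpha.
      by field; rewrite gt_eqF//; lra.
    have -> : 2 * n%:R * L = 2 * L * n%:R by ring.
    rewrite (powRM (beta / alpha)) //; last by lra.
    have -> : w = n%:R `^ (beta / alpha) / n%:R.
      rewrite /w -[in RHS](@powR_inv1 _ n%:R)// -powRD.
        by congr (_ `^ _); ring.
      by apply/implyP => _; rewrite gt_eqF//; lra.
    rewrite /k /q le_eqVlt; apply/orP; left; apply/eqP.
    by field; rewrite gt_eqF//; lra.
  rewrite ler_wpM2l//; apply: ge0_ler_powR; rewrite ?nnegrE//; lra.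
(* Against [p = 0] the overlap is [sqrt (1 - q)], and Bernoulli gives
   [(1 - q)^n >= 1 - n q = 1 / 2]. *)
have rn : 1 / 2 <= (Num.sqrt (1 - q) ^+ 2) ^+ n.
  rewrite sqr_sqrtr; last lra.
  apply: le_trans (@Bernoulli_inequality q n ltac:(lra)).
  have -> : n%:R * q = 1 / 2 by rewrite /q; field; rewrite gt_eqF//; lra.
  lra.
have w2 : 0 < w ^+ 2 by rewrite exprn_gt0.
rewrite ler_pdivlMl//.
have kq2 : (k * w) ^+ 2 <= (q * N%:R `^ (2 * beta)) ^+ 2.
  by rewrite lerXn2r// nnegrE mulr_ge0// ?powR_ge0// ltW.
have : (k * w) ^+ 2 * (1 / 2) <=
    (q * N%:R `^ (2 * beta)) ^+ 2 * (Num.sqrt (1 - q) ^+ 2) ^+ n.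
  by apply: ler_pM => //; exact: sqr_ge0.
rewrite exprMn; move: (k ^+ 2) (w ^+ 2) (_ ^+ n) ((q * _) ^+ 2) => *.
lra.
Qed.

End rates.

Theorem theorem5p5 (R : realType) (alpha beta L : R) :
  0 < beta -> beta < alpha -> 0 < L ->
  exists2 c : R, 0 < c &
    forall (H : hilbertType R) (e : hilbertBasis H)
           (K : forall n, tensor_power H n),
      (c%:E <= limn_einf (fun n => scaled_minimax_risk alpha beta L e (K n)))%E.
Proof.
move=> b0 ba L0; have [b2a|b2a] := leP (2 * beta) alpha.
  have [c c0 cR] := @parametric_rate _ _ _ _ b0 ba L0 b2a.
  exists c => // H e K; apply: limn_einf_ge.
  by exists 1%N => // n n0; exact: cR.
have [c c0 cR] := @nonparametric_rate _ _ _ _ b0 ba L0 b2a.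
exists c => // H e K; apply: limn_einf_ge.
(* From this index on [n >= 1 / (2 L)], that is [1 <= 2 n L]. *)
exists (Num.trunc (2 * L)^-1).+1 => // n /= nL; apply: cR.
have nV : (2 * L)^-1 <= n%:R.
  by apply: ltW (lt_le_trans (truncnS_gt _) _); rewrite ler_nat.
rewrite mulrAC mulrC -ler_pdivrMr; last by rewrite mulr_gt0.
by rewrite mul1r.
Qed.
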